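(* Let $c>0$ and let $(p,u,v)$, with $p,u,v:\mathbb{R}^2\times[0,\infty)\to\mathbb{R}$ of class $C^3$, be a solution of the two-dimensional acoustic equations $$\partial_t p + c(\partial_x u+\partial_y v)=0,\qquad \partial_t u + c\,\partial_x p=0,\qquad \partial_t v + c\,\partial_y p = 0 .$$ Fix $(x,y)\in\mathbb{R}^2$ and $t\ge 0$. For $\Delta t>0$ put $P=(x,y,t+\Delta t)$, $P'=(x,y,t)$ and $\mathbf{Q}(\theta)=(x+c\Delta t\cos\theta,\;y+c\Delta t\sin\theta,\;t)$ for $\theta\in[0,2\pi]$. Then, as $\Delta t\to 0$, $$p(P) = -p(P') + \frac{1}{\pi}\int_0^{2\pi} p(\mathbf{Q}(\theta))\,d\theta - \frac12\Big[u(\mathbf{Q}(0))-u(\mathbf{Q}(\pi))\Big] - \frac12\Big[v\big(\mathbf{Q}(\tfrac{\pi}{2})\big)-v\big(\mathbf{Q}(\tfrac{3\pi}{2})\big)\Big] + \mathcal{O}(\Delta t^3),$$ $$u(P) = -\frac12\Big[p(\mathbf{Q}(0))-p(\mathbf{Q}(\pi))\Big] + \frac1\pi\int_0^{2\pi}\Big[u(\mathbf{Q}(\theta))\big(2\cos^2\theta-\tfrac12\big)+2v(\mathbf{Q}(\theta))\sin\theta\cos\theta\Big]d\theta + \mathcal{O}(\Delta t^3),$$ $$v(P) = -\frac12\Big[p\big(\mathbf{Q}(\tfrac{\pi}{2})\big)-p\big(\mathbf{Q}(\tfrac{3\pi}{2})\big)\Big] + \frac1\pi\int_0^{2\pi}\Big[v(\mathbf{Q}(\theta))\big(2\sin^2\theta-\tfrac12\big)+2u(\mathbf{Q}(\theta))\sin\theta\cos\theta\Big]d\theta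 + \mathcal{O}(\Delta t^3).$$
   Context: Here $p$ is the pressure, $(u,v)$ the velocity and $c$ the constant speed of sound. The approximate evolution operator obtained by dropping the $\mathcal{O}(\Delta t^3)$ terms is called $\mathrm{EG}^{\text{quad}}$. The notation $\mathcal{O}(\Delta t^3)$ means a quantity bounded by $K\Delta t^3$ for all sufficiently small $\Delta t>0$, where $K$ may depend on the solution, on $c$, and on the fixed point $(x,y,t)$. *)

(* Defs.v *)
From Stdlib Require Import Reals.
From Coquelicot Require Import Coquelicot.

Open Scope R_scope.

(* Fields on R^2 x [0,oo) are total functions of a point (x, y, t); their
   values at t < 0 are never constrained and never used. *)
Definition point : Type := (R * R * R)%type.

Definition half_space (q : point) : Prop := 0 <= snd q.

(* Coquelicot's [is_derive] with the filter of neighbourhoods of [a] restricted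
   to [D]: for D = [0,oo) this is the usual derivative at a > 0 and the right
   derivative at a = 0. *)
Definition is_derive_within (D : R -> Prop) (f : R -> R) (a l : R) : Prop :=
  filterdiff f (within D (locally a)) (fun h : R => scal h l).

Definition is_partial_x (f fx : point -> R) : Prop :=
  forall x y t : R, 0 <= t ->
    is_derive (fun s : R => f (s, y, t)) x (fx (x, y, t)).

Definition is_partial_y (f fy : point -> R) : Prop :=
  forall x y t : R, 0 <= t ->
    is_derive (fun s : R => f (x, s, t)) y (fy (x, y, t)).

Definition is_partial_t (f ft : point -> R) : Prop :=
  forall x y t : R, 0 <= t ->
    is_derive_within (fun s : R => 0 <= s)
      (fun s : R => f (x, y, s)) t (ft (x, y, t)).

(* f is of class C^k on R^2 x [0,oo): all partial derivatives of order <= k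
   exist (one-sided in t at t = 0) and are continuous up to the boundary. *)
Fixpoint class_C (k : nat) (f : point -> R) : Prop :=
  continuous_on half_space f /\
  match k with
  | O => True
  | S k' =>
      exists fx fy ft : point -> R,
        is_partial_x f fx /\ is_partial_y f fy /\ is_partial_t f ft /\
        class_C k' fx /\ class_C k' fy /\ class_C k' ft
  end.

Definition acoustic_solution (c : R) (p u v : point -> R) : Prop :=
  exists pt px py ut ux vt vy : point -> R,
    is_partial_t p pt /\ is_partial_x p px /\ is_partial_y p py /\
    is_partial_t u ut /\ is_partial_x u ux /\
    is_partial_t v vt /\ is_partial_y v vy /\
    forall q : point, half_space q ->
      pt q + c * (ux q + vy q) = 0 /\
      ut q + c * px q = 0 /\
      vt q + c * py q = 0.

Definition Qpt (c x y t dt theta : R) : point :=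
  (x + c * dt * cos theta, y + c * dt * sin theta, t).

(* a(dt) = b(dt) + O(dt^3) as dt -> 0, dt > 0. *)
Definition eq_mod_O3 (a b : R -> R) : Prop :=
  exists K : R, at_right 0 (fun dt : R => Rabs (a dt - b dt) <= K * dt ^ 3).

(* Main.v *)
Require Import Defs.
From Stdlib Require Import Reals Lra.
From Coquelicot Require Import Coquelicot.

Open Scope R_scope.

(** Both sides of each formula have the same Taylor polynomial of degree two in
    [dt]. On the left, the expansion in time is converted into space derivatives
    at the centre [(x, y, t)] by the acoustic equations, used once for the first
    and twice for the second time derivative ([acoustic_time_expansion]); for the
    pressure this gives
    [p - c dt (u_x + v_y) + (c dt) ^ 2 / 2 (p_xx + p_yy)].

    On the right, each field on the circle of radius [c dt] equals its quadratic
    jet at the centre up to [O(dt ^ 3)], uniformly in the angle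
    ([circle_expansion]). Differences of values at opposite points of the circle
    produce the first derivatives. The integrals of the jet against the weights
    [1], [2 cos ^ 2 - 1 / 2], [2 sin ^ 2 - 1 / 2] and [2 sin cos] are
    computed exactly ([circle_mean_jet2] and its variants): by orthogonality of
    trigonometric functions they keep the value at the centre and just the second
    derivatives that appear on the left.

    As [t = 0] is allowed, the time derivatives may be one-sided. All expansions
    are therefore derived from a mean value inequality for derivatives within a
    set closed to the right, applied to one variable at a time
    ([taylor_two_variables]). Comparing the two orders of expansion shows that
    mixed derivatives commute up to the boundary ([mixed_partials_commute]), which
    is what the second time derivatives require. *)

(** * One-sided derivatives and Taylor estimates in one variable *)

(** The real line and the half line are treated together as sets closed under moving
    to the right: such a set is convex, and each of its points is a limit of
    other points of it, so that derivatives within it are unique. *)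
Definition up_closed (D : R -> Prop) : Prop :=
  forall a b : R, D a -> a <= b -> D b.

Lemma within_locally_proper (D : R -> Prop) (a : R) :
  D a -> ProperFilter (within D (locally a)).
Proof.
intros Da. split; [|apply within_filter; apply locally_filter].
intros P HP. exists a. exact (locally_singleton _ _ HP Da).
Qed.

Lemma is_derive_is_derive_within (D : R -> Prop) (f : R -> R) (a l : R) :
  D a -> is_derive f a l -> is_derive_within D f a l.
Proof.
intros Da H. unfold is_derive_within.
assert (PF := within_locally_proper D a Da).
apply (filterdiff_locally f a); [|exact H].
intros P HP. unfold within. apply filter_imp with (2 := HP). auto.
Qed.

Lemma is_derive_within_ext (D : R -> Prop) (f g : R -> R) (a l : R) :
  D a -> (forall s, D s -> f s = g s) ->
  is_derive_within D f a l -> is_derive_within D g a l.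
Proof.
intros Da E [Hl H]. split; [exact Hl|].
intros y Hy eps.
assert (PF := within_locally_proper D a Da).
assert (Ey : a = y).
{ apply (is_filter_lim_unique (F := within D (locally a)) a y); auto.
  intros P HP. unfold within. apply filter_imp with (2 := HP). auto. }
subst y.
generalize (H a Hy eps). unfold within. apply filter_imp.
intros s Hs Ds. rewrite <- (E s Ds), <- (E a Da). auto.
Qed.

Lemma is_derive_within_linear (D : R -> Prop) (f g : R -> R) (a lf lg c d : R) :
  is_derive_within D f a lf -> is_derive_within D g a lg ->
  is_derive_within D (fun s => c * f s + d * g s) a (c * lf + d * lg).
Proof.
intros Hf Hg. unfold is_derive_within.
apply filterdiff_ext_lin with
  (fun h : R => plus (scal c (scal h lf)) (scal d (scal h lg))).
- apply (filterdiff_plus_fct (fun s => scal c (f s)) (fun s => scal d (g s))).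
  + apply (filterdiff_scal_r_fct c f); [intros; apply Rmult_comm | exact Hf].
  + apply (filterdiff_scal_r_fct d g); [intros; apply Rmult_comm | exact Hg].
- intros h. unfold plus, scal; simpl; unfold mult; simpl. ring.
Qed.

Lemma is_derive_within_approx (D : R -> Prop) (f : R -> R) (a l : R) :
  is_derive_within D f a l ->
  forall eps : R, 0 < eps -> exists delta : R, 0 < delta /\
    forall s : R, D s -> Rabs (s - a) < delta ->
      Rabs (f s - f a - l * (s - a)) <= eps * Rabs (s - a).
Proof.
intros [_ H] eps Heps.
destruct (H a) with (eps := mkposreal eps Heps) as [d Hd].
- intros P HP. unfold within. apply filter_imp with (2 := HP). auto.
- exists d. split; [apply cond_pos|]. intros s Ds Hs.
  specialize (Hd s Hs Ds). simpl in Hd.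
  unfold norm, minus, plus, opp, scal in Hd; simpl in Hd.
  unfold abs, mult in Hd; simpl in Hd.
  replace (f s - f a - l * (s - a)) with (f s + - f a + - ((s + - a) * l)) by ring.
  exact Hd.
Qed.

(** Both affine approximations are compared at a point [a + h] with [h > 0],
    which lies in [D] because [D] is closed to the right. *)
Lemma is_derive_within_unique (D : R -> Prop) (f : R -> R) (a l1 l2 : R) :
  up_closed D -> D a ->
  is_derive_within D f a l1 -> is_derive_within D f a l2 -> l1 = l2.
Proof.
intros HD Da H1 H2.
apply cond_eq. intros eps Heps.
destruct (is_derive_within_approx _ _ _ _ H1 (eps / 4)) as [d1 [p1 K1]]; [lra|].
destruct (is_derive_within_approx _ _ _ _ H2 (eps / 4)) as [d2 [p2 K2]]; [lra|].
assert (Hm : 0 < Rmin d1 d2) by (apply Rmin_pos; auto).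
pose proof (Rmin_l d1 d2). pose proof (Rmin_r d1 d2).
set (h := Rmin d1 d2 / 2) in *.
assert (Hh : 0 < h) by (unfold h; lra).
assert (Eh : Rabs (a + h - a) = h)
  by (replace (a + h - a) with h by ring; apply Rabs_pos_eq; lra).
specialize (K1 (a + h)). specialize (K2 (a + h)). rewrite Eh in *.
assert (Dh : D (a + h)) by (apply HD with a; auto; lra).
specialize (K1 Dh ltac:(unfold h in *; lra)). specialize (K2 Dh ltac:(unfold h in *; lra)).
replace (a + h - a) with h in * by ring.
apply Rmult_lt_reg_r with h; auto.
rewrite <- (Rabs_pos_eq h) at 1 by lra. rewrite <- Rabs_mult.
replace ((l1 - l2) * h) with
  ((f (a + h) - f a - l2 * h) - (f (a + h) - f a - l1 * h)) by ring.
eapply Rle_lt_trans; [apply Rabs_triang|]. rewrite Rabs_Ropp. nra.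
Qed.

Lemma is_derive_within_interior (D : R -> Prop) (f : R -> R) (x l : R) :
  locally x D -> is_derive_within D f x l -> is_derive f x l.
Proof.
intros HD [Hl H]. split; [exact Hl|].
intros y Hy eps.
assert (E : y = x) by (symmetry; apply (is_filter_lim_locally_unique x y Hy)).
subst y.
assert (K := H x (fun P HP => filter_imp P _ (fun s Ps _ => Ps) HP) eps).
unfold within in K.
generalize (filter_and _ _ HD K). apply filter_imp. intros s [A B]. auto.
Qed.

(** The two-sided mean value theorem needs two-sided continuity at the ends of
    the segment, which a one-sided derivative does not give. Freezing [f]
    outside the segment provides it. *)
Lemma clamp_continuity (f : R -> R) (D : R -> Prop) (f1 : R -> R) (a b : R) :
  up_closed D -> D a -> a <= b ->
  (forall s, D s -> is_derive_within D f s (f1 s)) ->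
  forall x, continuity_pt (fun s => f (Rmax a (Rmin s b))) x.
Proof.
intros HD Da Hab H x.
set (k := fun s => Rmax a (Rmin s b)).
assert (Hk : forall s, a <= k s) by (intros s; apply Rmax_l).
assert (Lip : forall s, Rabs (k s - k x) <= Rabs (s - x)).
{ intros s. unfold k, Rmax, Rmin.
  repeat destruct Rle_dec; unfold Rabs; repeat destruct Rcase_abs; lra. }
assert (Dk : forall s, D (k s)) by (intros s; apply HD with a; auto).
destruct (is_derive_within_approx _ _ _ _ (H _ (Dk x)) 1 Rlt_0_1) as [d [pd Kd]].
(* Increments of [f] from [k x] are at most [C] times those of the argument. *)
set (C := Rabs (f1 (k x)) + 1).
assert (HC : 0 < C) by (unfold C; pose proof (Rabs_pos (f1 (k x))); lra).
intros eps Heps.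
exists (Rmin d (eps / C)). split.
{ apply Rmin_pos; auto. apply Rdiv_lt_0_compat; auto. }
intros s [_ Hs]. simpl in *. unfold R_dist in *.
pose proof (Rmin_l d (eps / C)). pose proof (Rmin_r d (eps / C)).
specialize (Kd (k s) (Dk s)). specialize (Lip s). fold (k s) (k x).
specialize (Kd ltac:(lra)).
replace (f (k s) - f (k x)) with
  ((f (k s) - f (k x) - f1 (k x) * (k s - k x)) + f1 (k x) * (k s - k x)) by ring.
eapply Rle_lt_trans; [apply Rabs_triang|]. rewrite (Rabs_mult (f1 (k x))).
apply Rle_lt_trans with (C * Rabs (s - x)).
- unfold C. pose proof (Rabs_pos (f1 (k x))). nra.
- replace eps with (C * (eps / C)) by (field; lra). apply Rmult_lt_compat_l; lra.
Qed.

(** The mean value theorem for the frozen function, which agrees with [f] on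
    the segment and is differentiable in the open interval. *)
Lemma mean_value_bound_le (D : R -> Prop) (f f1 : R -> R) (a b C : R) :
  up_closed D -> D a -> a < b ->
  (forall s, D s -> is_derive_within D f s (f1 s)) ->
  (forall s, a <= s <= b -> Rabs (f1 s) <= C) ->
  Rabs (f b - f a) <= C * (b - a).
Proof.
intros HD Da Hab H HC.
set (g := fun s => f (Rmax a (Rmin s b))).
destruct (MVT_gen g a b f1) as [z [Hz E]].
- rewrite Rmin_left, Rmax_right by lra. intros x Hx.
  assert (Lx : locally x (fun s => a < s < b)).
  { apply (locally_interval _ x a b); simpl; try lra. intros; split; auto. }
  apply is_derive_ext_loc with f.
  + generalize Lx. apply filter_imp. intros s Hs. unfold g.
    rewrite Rmin_left, Rmax_right; lra.
  + apply is_derive_within_interior with D.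
    * generalize Lx. apply filter_imp. intros s Hs. apply HD with a; auto; lra.
    * apply H. apply HD with a; auto; lra.
- intros x _. apply (clamp_continuity f D f1); auto; lra.
- rewrite Rmin_left, Rmax_right in Hz by lra.
  unfold g in E. rewrite !Rmin_left, !Rmax_right in E by lra.
  rewrite E, Rabs_mult, (Rabs_pos_eq (b - a)) by lra.
  apply Rmult_le_compat_r; [lra|auto].
Qed.

Lemma mean_value_bound (D : R -> Prop) (f f1 : R -> R) (a b C : R) :
  up_closed D -> D a -> D b ->
  (forall s, D s -> is_derive_within D f s (f1 s)) ->
  (forall s, D s -> Rabs (s - a) <= Rabs (b - a) -> Rabs (f1 s) <= C) ->
  Rabs (f b - f a) <= C * Rabs (b - a).
Proof.
intros HD Da Db H HC.
destruct (Rtotal_order a b) as [L|[E|L]].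
- rewrite (Rabs_pos_eq (b - a)) in * by lra.
  apply (mean_value_bound_le D f f1); auto.
  intros s Hs. apply HC; [apply HD with a; auto; lra|].
  rewrite Rabs_pos_eq; lra.
- subst b. rewrite !Rminus_diag, Rabs_R0. lra.
- rewrite (Rabs_minus_sym (f b)), (Rabs_minus_sym b) in *.
  rewrite (Rabs_pos_eq (a - b)) in * by lra.
  apply (mean_value_bound_le D f f1); auto.
  intros s Hs. apply HC; [apply HD with b; auto; lra|].
  rewrite Rabs_minus_sym, Rabs_pos_eq; lra.
Qed.

(** Subtracting a comparison function [q] whose derivative is close to that of
    [f]; with [q] a Taylor polynomial this raises the order of a remainder
    estimate by one. *)
Lemma mean_value_bound_minus (D : R -> Prop) (f f1 q q1 : R -> R) (a b C : R) :
  up_closed D -> D a -> D b ->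
  (forall s, D s -> is_derive_within D f s (f1 s)) ->
  (forall s, is_derive q s (q1 s)) ->
  (forall s, D s -> Rabs (s - a) <= Rabs (b - a) -> Rabs (f1 s - q1 s) <= C) ->
  Rabs ((f b - q b) - (f a - q a)) <= C * Rabs (b - a).
Proof.
intros HD Da Db Hf Hq HC.
replace (f b - q b - (f a - q a)) with
  ((1 * f b + -1 * q b) - (1 * f a + -1 * q a)) by ring.
apply (mean_value_bound D (fun s => 1 * f s + -1 * q s) (fun s => 1 * f1 s + -1 * q1 s)); auto.
- intros s Ds. apply is_derive_within_linear; auto. apply is_derive_is_derive_within; auto.
- intros s Ds Hs. replace (1 * f1 s + -1 * q1 s) with (f1 s - q1 s) by ring. auto.
Qed.

(** The remainder of [f] at order two has as derivative the remainder of [f1] at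
    order one. *)
Lemma taylor_order2 (D : R -> Prop) (f f1 f2 : R -> R) (a b M : R) :
  up_closed D -> D a -> D b ->
  (forall s, D s -> is_derive_within D f s (f1 s)) ->
  (forall s, D s -> is_derive_within D f1 s (f2 s)) ->
  (forall s, D s -> Rabs (s - a) <= Rabs (b - a) -> Rabs (f2 s) <= M) ->
  Rabs (f b - (f a + (b - a) * f1 a)) <= M * Rabs (b - a) ^ 2.
Proof.
intros HD Da Db H1 H2 HM.
pose proof (mean_value_bound_minus D f f1 (fun s => (s - a) * f1 a) (fun _ => f1 a)
  a b (M * Rabs (b - a)) HD Da Db H1) as K.
replace (f b - (f a + (b - a) * f1 a)) with
  (f b - (b - a) * f1 a - (f a - (a - a) * f1 a)) by ring.
replace (M * Rabs (b - a) ^ 2) with (M * Rabs (b - a) * Rabs (b - a)) by ring.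
apply K.
- intros s. auto_derive; auto. ring.
- intros s Ds Hs. apply Rle_trans with (M * Rabs (s - a)).
  + apply (mean_value_bound D f1 f2); auto. intros r Dr Hr. apply HM; auto. lra.
  + apply Rmult_le_compat_l; auto.
    apply Rle_trans with (Rabs (f2 s)); [apply Rabs_pos | auto].
Qed.

Lemma taylor_order3 (D : R -> Prop) (f f1 f2 f3 : R -> R) (a b M : R) :
  up_closed D -> D a -> D b ->
  (forall s, D s -> is_derive_within D f s (f1 s)) ->
  (forall s, D s -> is_derive_within D f1 s (f2 s)) ->
  (forall s, D s -> is_derive_within D f2 s (f3 s)) ->
  (forall s, D s -> Rabs (s - a) <= Rabs (b - a) -> Rabs (f3 s) <= M) ->
  Rabs (f b - (f a + (b - a) * f1 a + (b - a) ^ 2 / 2 * f2 a)) <= M * Rabs (b - a) ^ 3.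
Proof.
intros HD Da Db H1 H2 H3 HM.
pose proof (mean_value_bound_minus D f f1
  (fun s => (s - a) * f1 a + (s - a) ^ 2 / 2 * f2 a) (fun s => f1 a + (s - a) * f2 a)
  a b (M * Rabs (b - a) ^ 2) HD Da Db H1) as K. cbv beta in K.
replace (M * Rabs (b - a) ^ 3) with (M * Rabs (b - a) ^ 2 * Rabs (b - a)) by ring.
match goal with |- Rabs ?X <= _ => match type of K with _ -> _ -> Rabs ?Y <= _ =>
  replace X with Y by field end end.
apply K.
- intros s. auto_derive; auto. simpl. field.
- intros s Ds Hs. apply Rle_trans with (M * Rabs (s - a) ^ 2).
  + apply (taylor_order2 D f1 f2 f3); auto. intros r Dr Hr. apply HM; auto. lra.
  + apply Rmult_le_compat_l.
    * apply Rle_trans with (Rabs (f3 s)); [apply Rabs_pos | auto].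
    * apply pow_incr. split; [apply Rabs_pos | auto].
Qed.

(** * Taylor expansion and mixed derivatives in two variables *)

Definition partial1 (D1 D2 : R -> Prop) (F G : R -> R -> R) : Prop :=
  forall a b : R, D1 a -> D2 b -> is_derive_within D1 (fun s => F s b) a (G a b).

Definition partial2 (D1 D2 : R -> Prop) (F G : R -> R -> R) : Prop :=
  forall a b : R, D1 a -> D2 b -> is_derive_within D2 (fun s => F a s) b (G a b).

Definition locally_bounded2 (D1 D2 : R -> Prop) (F : R -> R -> R) : Prop :=
  forall a b : R, D1 a -> D2 b -> exists M delta : R, 0 < delta /\
    forall s r : R, D1 s -> D2 r -> Rabs (s - a) < delta -> Rabs (r - b) < delta ->
      Rabs (F s r) <= M.

(** What Taylor estimates retain of the class C^k: the derivatives up to order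
    [k] exist, one-sided at an end of the domain, and are locally bounded. *)
Fixpoint bounded_derivatives (D1 D2 : R -> Prop) (k : nat) (F : R -> R -> R) : Prop :=
  locally_bounded2 D1 D2 F /\
  match k with
  | O => True
  | S k' => exists F1 F2 : R -> R -> R,
      partial1 D1 D2 F F1 /\ partial2 D1 D2 F F2 /\
      bounded_derivatives D1 D2 k' F1 /\ bounded_derivatives D1 D2 k' F2
  end.

Lemma bounded_derivatives_swap (D1 D2 : R -> Prop) (k : nat) (F : R -> R -> R) :
  bounded_derivatives D1 D2 k F ->
  bounded_derivatives D2 D1 k (fun b a => F a b).
Proof.
revert F; induction k as [|k IH]; intros F [HB H]; split.
1, 3: intros b a Db Da; destruct (HB a b Da Db) as [M [d [pd K]]];
  exists M, d; split; auto.
- exact I.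
- destruct H as [F1 [F2 [P1 [P2 [S1 S2]]]]].
  exists (fun b a => F2 a b), (fun b a => F1 a b).
  refine (conj _ (conj _ (conj (IH _ S2) (IH _ S1)))).
  + exact (fun b a Db Da => P2 a b Da Db).
  + exact (fun b a Db Da => P1 a b Da Db).
Qed.

Lemma bounded_derivatives_ext (D1 D2 : R -> Prop) (k : nat) (F G : R -> R -> R) :
  (forall a b, D1 a -> D2 b -> F a b = G a b) ->
  bounded_derivatives D1 D2 k F -> bounded_derivatives D1 D2 k G.
Proof.
intros E.
assert (HB : locally_bounded2 D1 D2 F -> locally_bounded2 D1 D2 G).
{ intros HB a b Da Db. destruct (HB a b Da Db) as [M [d [pd K]]].
  exists M, d. split; auto. intros s r Ds Dr. rewrite <- E by auto. auto. }
destruct k as [|k]; intros [H0 H]; split; auto.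
destruct H as [F1 [F2 [P1 [P2 [S1 S2]]]]].
exists F1, F2. refine (conj _ (conj _ (conj S1 S2))); intros a b Da Db.
- apply is_derive_within_ext with (fun s => F s b); auto.
- apply is_derive_within_ext with (fun s => F a s); auto.
Qed.

(** The derivatives provided by the definition are some functions; by uniqueness
    they agree with the given [G] on the domain, which makes the bounds
    available for [G]. *)
Lemma bounded_derivatives_partial1 (D1 D2 : R -> Prop) (k : nat) (F G : R -> R -> R) :
  up_closed D1 -> up_closed D2 ->
  bounded_derivatives D1 D2 (S k) F -> partial1 D1 D2 F G ->
  bounded_derivatives D1 D2 k G.
Proof.
intros U1 U2 [_ [F1 [F2 [P1 [_ [S1 _]]]]]] PG.
apply bounded_derivatives_ext with F1; auto.
intros a b Da Db.
apply is_derive_within_unique with D1 (fun s => F s b) a; auto.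
Qed.

Lemma bounded_derivatives_partial2 (D1 D2 : R -> Prop) (k : nat) (F G : R -> R -> R) :
  up_closed D1 -> up_closed D2 ->
  bounded_derivatives D1 D2 (S k) F -> partial2 D1 D2 F G ->
  bounded_derivatives D1 D2 k G.
Proof.
intros U1 U2 [_ [F1 [F2 [_ [P2 [_ S2]]]]]] PG.
apply bounded_derivatives_ext with F2; auto.
intros a b Da Db.
apply is_derive_within_unique with D2 (fun s => F a s) b; auto.
Qed.

(** The Taylor polynomial of degree two in the increments [h] and [k]. There is a
    single mixed coefficient, as the expansion is made in one variable after the
    other. *)
Definition jet2 (f0 f1 f2 f11 f12 f22 h k : R) : R :=
  f0 + h * f1 + k * f2 + h ^ 2 / 2 * f11 + h * k * f12 + k ^ 2 / 2 * f22.

Lemma bounded_derivatives_at (D1 D2 : R -> Prop) (F : R -> R -> R) (a b : R) :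
  bounded_derivatives D1 D2 0 F -> D1 a -> D2 b ->
  exists M delta : R, 0 <= M /\ 0 < delta /\
    forall s r : R, D1 s -> D2 r -> Rabs (s - a) < delta -> Rabs (r - b) < delta ->
      Rabs (F s r) <= M.
Proof.
intros [HB _] Da Db. destruct (HB a b Da Db) as [M [d [pd K]]].
exists M, d. split; auto.
apply Rle_trans with (Rabs (F a b)); [apply Rabs_pos|].
apply K; auto; rewrite Rminus_diag, Rabs_R0; auto.
Qed.

(** Expand in the first variable along the line at height [b + k]: this costs
    [h ^ 3] and leaves [F], [F1], [F11] at [(a, b + k)]. These three are expanded
    in the second variable to orders three, two and one; after multiplication
    by [1], [h] and [h ^ 2 / 2] each remainder is again cubic. Only
    one-dimensional estimates occur, and these hold at a boundary point of the
    domain as they do inside. *)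
Lemma taylor_two_variables (D1 D2 : R -> Prop)
  (F F1 F2 F11 F12 F22 : R -> R -> R) (a b : R) :
  up_closed D1 -> up_closed D2 ->
  bounded_derivatives D1 D2 3 F ->
  partial1 D1 D2 F F1 -> partial2 D1 D2 F F2 ->
  partial1 D1 D2 F1 F11 -> partial2 D1 D2 F1 F12 -> partial2 D1 D2 F2 F22 ->
  D1 a -> D2 b ->
  exists K delta : R, 0 <= K /\ 0 < delta /\
    forall h k r : R, D1 (a + h) -> D2 (b + k) ->
      Rabs h <= r -> Rabs k <= r -> r < delta ->
      Rabs (F (a + h) (b + k)
        - jet2 (F a b) (F1 a b) (F2 a b) (F11 a b) (F12 a b) (F22 a b) h k)
      <= K * r ^ 3.
Proof.
intros U1 U2 S0 P1 P2 P11 P12 P22 Da Db.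
assert (S1 := bounded_derivatives_partial1 _ _ _ _ _ U1 U2 S0 P1).
assert (S2 := bounded_derivatives_partial2 _ _ _ _ _ U1 U2 S0 P2).
assert (S11 := bounded_derivatives_partial1 _ _ _ _ _ U1 U2 S1 P11).
assert (S12 := bounded_derivatives_partial2 _ _ _ _ _ U1 U2 S1 P12).
assert (S22 := bounded_derivatives_partial2 _ _ _ _ _ U1 U2 S2 P22).
destruct S11 as [_ [F111 [F112 [P111 [P112 [S111 S112]]]]]].
destruct S12 as [_ [_ [F122 [_ [P122 [_ S122]]]]]].
destruct S22 as [_ [_ [F222 [_ [P222 [_ S222]]]]]].
destruct (bounded_derivatives_at _ _ _ a b S111 Da Db) as [M1 [d1 [m1 [p1 B1]]]].
destruct (bounded_derivatives_at _ _ _ a b S112 Da Db) as [M2 [d2 [m2 [p2 B2]]]].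
destruct (bounded_derivatives_at _ _ _ a b S122 Da Db) as [M3 [d3 [m3 [p3 B3]]]].
destruct (bounded_derivatives_at _ _ _ a b S222 Da Db) as [M4 [d4 [m4 [p4 B4]]]].
exists (M1 + M2 + M3 + M4), (Rmin (Rmin d1 d2) (Rmin d3 d4)).
split; [lra|]. split; [repeat apply Rmin_pos; auto|].
intros h k r Dh Dk Hh Hk Hr.
apply Rmin_Rgt_l in Hr. destruct Hr as [Hr1 Hr2].
apply Rmin_Rgt_l in Hr1. apply Rmin_Rgt_l in Hr2.
assert (E0 : Rabs (a - a) = 0) by (rewrite Rminus_diag; apply Rabs_R0).
assert (Eh : a + h - a = h) by ring. assert (Ek : b + k - b = k) by ring.
assert (T1 := taylor_order3 D1 (fun s => F s (b + k)) (fun s => F1 s (b + k))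
  (fun s => F11 s (b + k)) (fun s => F111 s (b + k)) a (a + h) M1 U1 Da Dh
  (fun s Ds => P1 s _ Ds Dk) (fun s Ds => P11 s _ Ds Dk) (fun s Ds => P111 s _ Ds Dk)).
assert (T2 := mean_value_bound D2 (fun s => F11 a s) (fun s => F112 a s)
  b (b + k) M2 U2 Db Dk (fun s Ds => P112 a s Da Ds)).
assert (T3 := taylor_order2 D2 (fun s => F1 a s) (fun s => F12 a s) (fun s => F122 a s)
  b (b + k) M3 U2 Db Dk (fun s Ds => P12 a s Da Ds) (fun s Ds => P122 a s Da Ds)).
assert (T4 := taylor_order3 D2 (fun s => F a s) (fun s => F2 a s)
  (fun s => F22 a s) (fun s => F222 a s) b (b + k) M4 U2 Db Dk
  (fun s Ds => P2 a s Da Ds) (fun s Ds => P22 a s Da Ds) (fun s Ds => P222 a s Da Ds)).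
cbv beta in T1, T2, T3, T4. rewrite Eh, Ek in *.
specialize (T1 ltac:(intros s Ds Hs; apply B1; auto; rewrite ?Ek; lra)).
specialize (T2 ltac:(intros s Ds Hs; apply B2; auto; rewrite ?E0; lra)).
specialize (T3 ltac:(intros s Ds Hs; apply B3; auto; rewrite ?E0; lra)).
specialize (T4 ltac:(intros s Ds Hs; apply B4; auto; rewrite ?E0; lra)).
(* The four one-dimensional remainders, whose weighted sum is the total one. *)
set (X1 := F (a + h) (b + k) - _) in T1.
set (X2 := F11 a (b + k) - _) in T2.
set (X3 := F1 a (b + k) - _) in T3.
set (X4 := F a (b + k) - _) in T4.
replace (F (a + h) (b + k) - _) with (X1 + X4 + h * X3 + h ^ 2 / 2 * X2)
  by (unfold X1, X2, X3, X4, jet2; field).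
pose proof (Rabs_pos h) as h0. pose proof (Rabs_pos k) as k0.
assert (r0 : 0 <= r) by lra.
assert (h3 : Rabs h ^ 3 <= r ^ 3) by (apply pow_incr; auto).
assert (k3 : Rabs k ^ 3 <= r ^ 3) by (apply pow_incr; auto).
assert (k2 : Rabs k ^ 2 <= r ^ 2) by (apply pow_incr; auto).
assert (h2 : Rabs (h ^ 2 / 2) <= r ^ 2).
{ rewrite Rabs_pos_eq by (pose proof (pow2_ge_0 h); lra).
  pose proof (pow_incr _ _ 2 (conj h0 Hh)) as W. rewrite pow2_abs in W.
  pose proof (pow2_ge_0 h). lra. }
assert (Q3 : Rabs (h * X3) <= M3 * r ^ 3).
{ rewrite Rabs_mult. replace (M3 * r ^ 3) with (r * (M3 * r ^ 2)) by ring.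
  apply Rmult_le_compat; auto using Rabs_pos.
  apply Rle_trans with (1 := T3). apply Rmult_le_compat_l; auto. }
assert (Q2 : Rabs (h ^ 2 / 2 * X2) <= M2 * r ^ 3).
{ rewrite Rabs_mult. replace (M2 * r ^ 3) with (r ^ 2 * (M2 * r)) by ring.
  apply Rmult_le_compat; auto using Rabs_pos.
  apply Rle_trans with (1 := T2). apply Rmult_le_compat_l; auto. }
assert (Q1 : M1 * Rabs h ^ 3 <= M1 * r ^ 3) by (apply Rmult_le_compat_l; auto).
assert (Q4 : M4 * Rabs k ^ 3 <= M4 * r ^ 3) by (apply Rmult_le_compat_l; auto).
pose proof (Rabs_triang (X1 + X4 + h * X3) (h ^ 2 / 2 * X2)).
pose proof (Rabs_triang (X1 + X4) (h * X3)).
pose proof (Rabs_triang X1 X4).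
lra.
Qed.

(** Expanding in the two possible orders gives two quadratic polynomials that
    differ from [F] by [O(r ^ 3)] at [(a + r, b + r)]. They differ from each other
    by [r ^ 2] times the difference of the mixed derivatives, which therefore
    vanishes. The argument is valid at a boundary point. *)
Lemma mixed_partials_commute (D1 D2 : R -> Prop)
  (F F1 F2 F12 F21 : R -> R -> R) (a b : R) :
  up_closed D1 -> up_closed D2 ->
  bounded_derivatives D1 D2 3 F ->
  partial1 D1 D2 F F1 -> partial2 D1 D2 F1 F12 ->
  partial2 D1 D2 F F2 -> partial1 D1 D2 F2 F21 ->
  D1 a -> D2 b -> F12 a b = F21 a b.
Proof.
intros U1 U2 S0 P1 P12 P2 P21 Da Db.
assert (S1 := bounded_derivatives_partial1 _ _ _ _ _ U1 U2 S0 P1).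
assert (S2 := bounded_derivatives_partial2 _ _ _ _ _ U1 U2 S0 P2).
destruct S1 as [_ [F11 [_ [P11 [_ _]]]]].
destruct S2 as [_ [_ [F22 [_ [P22 _]]]]].
destruct (taylor_two_variables D1 D2 F F1 F2 F11 F12 F22 a b)
  as [K [d [K0 [d0 T]]]]; auto.
destruct (taylor_two_variables D2 D1 (fun y x => F x y) (fun y x => F2 x y)
  (fun y x => F1 x y) (fun y x => F22 x y) (fun y x => F21 x y) (fun y x => F11 x y) b a)
  as [K' [d' [K0' [d0' T']]]]; auto using bounded_derivatives_swap;
  try (intros y x Dy Dx; auto; fail).
apply cond_eq. intros eps Heps.
(* Both expansions hold at [r], and [(K + K') * r < eps]. *)
set (r := Rmin (Rmin d d') (eps / (K + K' + 1)) / 2).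
assert (He : 0 < eps / (K + K' + 1)) by (apply Rdiv_lt_0_compat; lra).
assert (Hm : 0 < Rmin (Rmin d d') (eps / (K + K' + 1))) by (repeat apply Rmin_pos; auto).
pose proof (Rmin_l (Rmin d d') (eps / (K + K' + 1))).
pose proof (Rmin_r (Rmin d d') (eps / (K + K' + 1))).
pose proof (Rmin_l d d'). pose proof (Rmin_r d d').
assert (r0 : 0 < r) by (unfold r; lra).
assert (Er : Rabs r = r) by (apply Rabs_pos_eq; lra).
assert (Dar : D1 (a + r)) by (apply U1 with a; auto; lra).
assert (Dbr : D2 (b + r)) by (apply U2 with b; auto; lra).
specialize (T r r r Dar Dbr ltac:(lra) ltac:(lra) ltac:(unfold r in *; lra)).
specialize (T' r r r Dbr Dar ltac:(lra) ltac:(lra) ltac:(unfold r in *; lra)).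
cbv beta in T'.
assert (B : Rabs ((F12 a b - F21 a b) * r ^ 2) <= (K + K') * r ^ 3).
{ replace ((F12 a b - F21 a b) * r ^ 2) with
   ((F (a + r) (b + r) - jet2 (F a b) (F2 a b) (F1 a b) (F22 a b) (F21 a b) (F11 a b) r r)
   - (F (a + r) (b + r) - jet2 (F a b) (F1 a b) (F2 a b) (F11 a b) (F12 a b) (F22 a b) r r))
   by (unfold jet2; field).
  eapply Rle_trans; [apply Rabs_triang|]. rewrite Rabs_Ropp. lra. }
assert (r2 : 0 < r ^ 2) by (apply pow_lt; auto).
rewrite Rabs_mult, (Rabs_pos_eq (r ^ 2)) in B by lra.
assert (B' : Rabs (F12 a b - F21 a b) <= (K + K') * r).
{ apply Rmult_le_reg_r with (r ^ 2); auto. lra. }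
assert (Ee : eps = (K + K' + 1) * (eps / (K + K' + 1))) by (field; lra).
assert (r < eps / (K + K' + 1)) by (unfold r; lra).
apply Rle_lt_trans with (1 := B'). rewrite Ee.
apply Rle_lt_trans with ((K + K') * (eps / (K + K' + 1))); nra.
Qed.

(** * Planar slices of fields on the half space *)

Definition whole_line (s : R) : Prop := True.
Definition half_line (s : R) : Prop := 0 <= s.

Lemma up_closed_whole_line : up_closed whole_line.
Proof. intros a b _ _; exact I. Qed.

Lemma up_closed_half_line : up_closed half_line.
Proof. intros a b. apply Rle_trans. Qed.

#[local] Hint Resolve up_closed_whole_line up_closed_half_line : core.
#[local] Hint Extern 1 (whole_line _) => exact I : core.

Lemma class_C_continuous (k : nat) (f : point -> R) :
  class_C k f -> continuous_on half_space f.
Proof. destruct k; intros [H _]; exact H. Qed.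

Lemma class_C_locally_bounded (k : nat) (f : point -> R) (x y t : R) :
  class_C k f -> 0 <= t ->
  exists M delta : R, 0 < delta /\
    forall x' y' t' : R, 0 <= t' ->
      Rabs (x' - x) < delta -> Rabs (y' - y) < delta -> Rabs (t' - t) < delta ->
      Rabs (f (x', y', t')) <= M.
Proof.
intros Hf Ht.
assert (Hc := class_C_continuous k f Hf (x, y, t) Ht).
specialize (Hc _ (locally_ball (f (x, y, t)) (mkposreal 1 Rlt_0_1))).
destruct Hc as [d Hd].
exists (Rabs (f (x, y, t)) + 1), d. split; [apply cond_pos|].
intros x' y' t' Ht' Hx Hy Hs.
assert (K := Hd (x', y', t') (conj (conj Hx Hy) Hs) Ht').
change (Rabs (f (x', y', t') - f (x, y, t)) < 1) in K.
pose proof (Rabs_triang (f (x', y', t') - f (x, y, t)) (f (x, y, t))) as T.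
replace (f (x', y', t') - f (x, y, t) + f (x, y, t)) with (f (x', y', t')) in T by ring.
lra.
Qed.

Lemma is_partial_x_slice_xy (f fx : point -> R) (t : R) :
  0 <= t -> is_partial_x f fx ->
  partial1 whole_line whole_line (fun x y => f (x, y, t)) (fun x y => fx (x, y, t)).
Proof.
intros Ht H a b _ _. apply is_derive_is_derive_within; [exact I | apply H, Ht].
Qed.

Lemma is_partial_y_slice_xy (f fy : point -> R) (t : R) :
  0 <= t -> is_partial_y f fy ->
  partial2 whole_line whole_line (fun x y => f (x, y, t)) (fun x y => fy (x, y, t)).
Proof.
intros Ht H a b _ _. apply is_derive_is_derive_within; [exact I | apply H, Ht].
Qed.

Lemma is_partial_x_slice_xt (f fx : point -> R) (y : R) :
  is_partial_x f fx ->
  partial1 whole_line half_line (fun x s => f (x, y, s)) (fun x s => fx (x, y, s)).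
Proof.
intros H a b _ Hb. apply is_derive_is_derive_within; [exact I | apply H, Hb].
Qed.

Lemma is_partial_t_slice_xt (f ft : point -> R) (y : R) :
  is_partial_t f ft ->
  partial2 whole_line half_line (fun x s => f (x, y, s)) (fun x s => ft (x, y, s)).
Proof. intros H a b _ Hb. apply H, Hb. Qed.

Lemma is_partial_y_slice_yt (f fy : point -> R) (x : R) :
  is_partial_y f fy ->
  partial1 whole_line half_line (fun y s => f (x, y, s)) (fun y s => fy (x, y, s)).
Proof.
intros H a b _ Hb. apply is_derive_is_derive_within; [exact I | apply H, Hb].
Qed.

Lemma is_partial_t_slice_yt (f ft : point -> R) (x : R) :
  is_partial_t f ft ->
  partial2 whole_line half_line (fun y s => f (x, y, s)) (fun y s => ft (x, y, s)).
Proof. intros H a b _ Hb. apply H, Hb. Qed.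

#[local] Hint Resolve is_partial_x_slice_xy is_partial_y_slice_xy
  is_partial_x_slice_xt is_partial_t_slice_xt
  is_partial_y_slice_yt is_partial_t_slice_yt : core.

Lemma class_C_slice_xy (k : nat) (f : point -> R) (t : R) :
  0 <= t -> class_C k f ->
  bounded_derivatives whole_line whole_line k (fun x y => f (x, y, t)).
Proof.
intros Ht. revert f; induction k as [|k IH]; intros f Hf.
all: split; [intros a b _ _;
  destruct (class_C_locally_bounded _ f a b t Hf Ht) as [M [d [pd K]]];
  exists M, d; split; auto; intros s r _ _ Hs Hr; apply K; auto;
  rewrite Rminus_diag, Rabs_R0; auto |].
- exact I.
- destruct Hf as [_ [fx [fy [ft [Px [Py [_ [Cx [Cy _]]]]]]]]].
  exists (fun x y => fx (x, y, t)), (fun x y => fy (x, y, t)). auto.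
Qed.

Lemma class_C_slice_xt (k : nat) (f : point -> R) (y : R) :
  class_C k f -> bounded_derivatives whole_line half_line k (fun x s => f (x, y, s)).
Proof.
revert f; induction k as [|k IH]; intros f Hf.
all: split; [intros a b _ Hb;
  destruct (class_C_locally_bounded _ f a y b Hf Hb) as [M [d [pd K]]];
  exists M, d; split; auto; intros s r _ Dr Hs Hr; apply K; auto;
  rewrite Rminus_diag, Rabs_R0; auto |].
- exact I.
- destruct Hf as [_ [fx [fy [ft [Px [_ [Pt [Cx [_ Ct]]]]]]]]].
  exists (fun x s => fx (x, y, s)), (fun x s => ft (x, y, s)). auto.
Qed.

Lemma class_C_slice_yt (k : nat) (f : point -> R) (x : R) :
  class_C k f -> bounded_derivatives whole_line half_line k (fun y s => f (x, y, s)).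
Proof.
revert f; induction k as [|k IH]; intros f Hf.
all: split; [intros a b _ Hb;
  destruct (class_C_locally_bounded _ f x a b Hf Hb) as [M [d [pd K]]];
  exists M, d; split; auto; intros s r _ Dr Hs Hr; apply K; auto;
  rewrite Rminus_diag, Rabs_R0; auto |].
- exact I.
- destruct Hf as [_ [fx [fy [ft [_ [Py [Pt [_ [Cy Ct]]]]]]]]].
  exists (fun y s => fy (x, y, s)), (fun y s => ft (x, y, s)). auto.
Qed.

Lemma mixed_partials_xy (f fx fy fxy fyx : point -> R) :
  class_C 3 f ->
  is_partial_x f fx -> is_partial_y fx fxy ->
  is_partial_y f fy -> is_partial_x fy fyx ->
  forall x y t : R, 0 <= t -> fxy (x, y, t) = fyx (x, y, t).
Proof.
intros Hf Px Pxy Py Pyx x y t Ht.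
apply (mixed_partials_commute whole_line whole_line (fun a b => f (a, b, t))
  (fun a b => fx (a, b, t)) (fun a b => fy (a, b, t))
  (fun a b => fxy (a, b, t)) (fun a b => fyx (a, b, t)) x y); auto.
apply class_C_slice_xy; auto.
Qed.

Lemma mixed_partials_xt (f fx ft fxt ftx : point -> R) :
  class_C 3 f ->
  is_partial_x f fx -> is_partial_t fx fxt ->
  is_partial_t f ft -> is_partial_x ft ftx ->
  forall x y t : R, 0 <= t -> fxt (x, y, t) = ftx (x, y, t).
Proof.
intros Hf Px Pxt Pt Ptx x y t Ht.
apply (mixed_partials_commute whole_line half_line (fun a b => f (a, y, b))
  (fun a b => fx (a, y, b)) (fun a b => ft (a, y, b))
  (fun a b => fxt (a, y, b)) (fun a b => ftx (a, y, b)) x t); auto.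
apply class_C_slice_xt; auto.
Qed.

Lemma mixed_partials_yt (f fy ft fyt fty : point -> R) :
  class_C 3 f ->
  is_partial_y f fy -> is_partial_t fy fyt ->
  is_partial_t f ft -> is_partial_y ft fty ->
  forall x y t : R, 0 <= t -> fyt (x, y, t) = fty (x, y, t).
Proof.
intros Hf Py Pyt Pt Pty x y t Ht.
apply (mixed_partials_commute whole_line half_line (fun a b => f (x, a, b))
  (fun a b => fy (x, a, b)) (fun a b => ft (x, a, b))
  (fun a b => fyt (x, a, b)) (fun a b => fty (x, a, b)) y t); auto.
apply class_C_slice_yt; auto.
Qed.

(** * Agreement up to cubic order *)

Lemma eq_mod_O3_intro (a b : R -> R) (K delta : R) :
  0 < delta ->
  (forall dt : R, 0 < dt < delta -> Rabs (a dt - b dt) <= K * dt ^ 3) ->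
  eq_mod_O3 a b.
Proof.
intros Hd H. exists K, (mkposreal delta Hd). intros dt Hdt Hpos.
apply H. split; auto.
change (Rabs (dt - 0) < delta) in Hdt. rewrite Rminus_0_r in Hdt.
pose proof (Rle_abs dt). lra.
Qed.

Lemma eq_mod_O3_linear (a b a' b' : R -> R) (l m : R) :
  eq_mod_O3 a b -> eq_mod_O3 a' b' ->
  eq_mod_O3 (fun dt => l * a dt + m * a' dt) (fun dt => l * b dt + m * b' dt).
Proof.
intros [K H] [K' H']. exists (Rabs l * K + Rabs m * K').
generalize (filter_and _ _ H H'). apply filter_imp. intros dt [B B'].
replace (l * a dt + m * a' dt - (l * b dt + m * b' dt)) with
  (l * (a dt - b dt) + m * (a' dt - b' dt)) by ring.
eapply Rle_trans; [apply Rabs_triang|]. rewrite !Rabs_mult.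
pose proof (Rmult_le_compat_l _ _ _ (Rabs_pos l) B).
pose proof (Rmult_le_compat_l _ _ _ (Rabs_pos m) B'). lra.
Qed.

Lemma eq_mod_O3_of_eq (a b : R -> R) : (forall dt, a dt = b dt) -> eq_mod_O3 a b.
Proof.
intros E. exists 0. apply filter_forall. intros dt.
rewrite E, Rminus_diag, Rabs_R0. lra.
Qed.

Lemma eq_mod_O3_ext (a b a' b' : R -> R) :
  (forall dt, a dt = a' dt) -> (forall dt, b dt = b' dt) ->
  eq_mod_O3 a b -> eq_mod_O3 a' b'.
Proof.
intros Ea Eb [K H]. exists K. revert H. apply filter_imp. intros dt.
rewrite Ea, Eb. auto.
Qed.

Lemma eq_mod_O3_trans_sym (a b a' : R -> R) :
  eq_mod_O3 a b -> eq_mod_O3 a' b -> eq_mod_O3 a a'.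
Proof.
intros [K H] [K' H']. exists (K + K').
generalize (filter_and _ _ H H'). apply filter_imp. intros dt [B B'].
replace (a dt - a' dt) with ((a dt - b dt) - (a' dt - b dt)) by ring.
eapply Rle_trans; [apply Rabs_triang|]. rewrite Rabs_Ropp. lra.
Qed.

(** * Expansions in time and on the circle *)

(** The two-variable expansion in [(x, t)] with a zero increment in [x]. *)
Lemma time_taylor (f f1 f2 : point -> R) (x y t : R) :
  0 <= t -> class_C 3 f -> is_partial_t f f1 -> is_partial_t f1 f2 ->
  eq_mod_O3 (fun dt => f (x, y, t + dt))
    (fun dt => f (x, y, t) + dt * f1 (x, y, t) + dt ^ 2 / 2 * f2 (x, y, t)).
Proof.
intros Ht Hf P1 P2.
pose proof Hf as [_ [fx [_ [_ [Px [_ [_ [Cx _]]]]]]]].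
destruct Cx as [_ [fxx [_ [fxt [Pxx [_ [Pxt _]]]]]]].
destruct (taylor_two_variables whole_line half_line (fun a b => f (a, y, b))
  (fun a b => fx (a, y, b)) (fun a b => f1 (a, y, b))
  (fun a b => fxx (a, y, b)) (fun a b => fxt (a, y, b)) (fun a b => f2 (a, y, b)) x t)
  as [K [d [K0 [d0 T]]]]; auto.
{ apply class_C_slice_xt; auto. }
apply (eq_mod_O3_intro _ _ K d d0). intros dt Hdt.
specialize (T 0 dt dt I). cbv beta in T. rewrite Rplus_0_r, Rabs_R0 in T.
rewrite Rabs_pos_eq in T by lra.
assert (Hs : half_line (t + dt)) by (unfold half_line; lra).
specialize (T Hs ltac:(lra) ltac:(lra) ltac:(lra)).
replace (f (x, y, t) + dt * f1 (x, y, t) + dt ^ 2 / 2 * f2 (x, y, t)) with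
  (jet2 (f (x, y, t)) (fx (x, y, t)) (f1 (x, y, t)) (fxx (x, y, t))
    (fxt (x, y, t)) (f2 (x, y, t)) 0 dt) by (unfold jet2; field).
exact T.
Qed.

(** Agreement up to [O(dt ^ 3)] uniformly in the angle, as needed to integrate over
    the circle. *)
Definition uniformly_eq_mod_O3 (g J : R -> R -> R) : Prop :=
  exists K delta : R, 0 <= K /\ 0 < delta /\
    forall dt theta : R, 0 < dt < delta ->
      Rabs (g dt theta - J dt theta) <= K * dt ^ 3.

Lemma circle_taylor (c : R) (f fx fy fxx fxy fyy : point -> R) (x y t : R) :
  0 < c -> 0 <= t -> class_C 3 f ->
  is_partial_x f fx -> is_partial_y f fy ->
  is_partial_x fx fxx -> is_partial_y fx fxy -> is_partial_y fy fyy ->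
  uniformly_eq_mod_O3 (fun dt theta => f (Qpt c x y t dt theta))
    (fun dt theta => jet2 (f (x, y, t)) (fx (x, y, t)) (fy (x, y, t))
      (fxx (x, y, t)) (fxy (x, y, t)) (fyy (x, y, t))
      (c * dt * cos theta) (c * dt * sin theta)).
Proof.
intros Hc Ht Hf Px Py Pxx Pxy Pyy.
destruct (taylor_two_variables whole_line whole_line (fun a b => f (a, b, t))
  (fun a b => fx (a, b, t)) (fun a b => fy (a, b, t))
  (fun a b => fxx (a, b, t)) (fun a b => fxy (a, b, t)) (fun a b => fyy (a, b, t)) x y)
  as [K [d [K0 [d0 T]]]]; auto.
{ apply class_C_slice_xy; auto. }
exists (K * c ^ 3), (d / c). split; [|split].
- apply Rmult_le_pos; auto. apply pow_le; lra.
- apply Rdiv_lt_0_compat; auto.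
- intros dt theta Hdt.
  assert (r0 : 0 < c * dt) by (apply Rmult_lt_0_compat; lra).
  assert (r1 : c * dt < d).
  { replace d with (c * (d / c)) by (field; lra). apply Rmult_lt_compat_l; lra. }
  assert (bound : forall z, -1 <= z <= 1 -> Rabs (c * dt * z) <= c * dt).
  { intros z Hz. rewrite Rabs_mult, (Rabs_pos_eq (c * dt)) by lra.
    assert (Rabs z <= 1) by (apply Rabs_le; lra). nra. }
  replace (K * c ^ 3 * dt ^ 3) with (K * (c * dt) ^ 3) by ring.
  apply T; auto.
  + apply bound, COS_bound.
  + apply bound, SIN_bound.
Qed.

Lemma uniformly_eq_mod_O3_at (g J : R -> R -> R) (theta : R) :
  uniformly_eq_mod_O3 g J -> eq_mod_O3 (fun dt => g dt theta) (fun dt => J dt theta).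
Proof.
intros [K [d [_ [d0 H]]]]. apply (eq_mod_O3_intro _ _ K d d0). auto.
Qed.

(** The bound 2 on the weight is the one satisfied by all the weights used
    below. *)
Lemma uniformly_eq_mod_O3_RInt (w : R -> R) (g J : R -> R -> R) :
  (forall theta, Rabs (w theta) <= 2) ->
  (forall dt, ex_RInt (fun theta => w theta * g dt theta) 0 (2 * PI)) ->
  (forall dt, ex_RInt (fun theta => w theta * J dt theta) 0 (2 * PI)) ->
  uniformly_eq_mod_O3 g J ->
  eq_mod_O3 (fun dt => RInt (fun theta => w theta * g dt theta) 0 (2 * PI))
    (fun dt => RInt (fun theta => w theta * J dt theta) 0 (2 * PI)).
Proof.
intros Hw Ig IJ [K [d [K0 [d0 H]]]].
apply (eq_mod_O3_intro _ _ ((2 * PI - 0) * (2 * K)) d d0). intros dt Hdt.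
pose proof PI_RGT_0.
change (Rabs (minus (RInt (fun theta => w theta * g dt theta) 0 (2 * PI))
  (RInt (fun theta => w theta * J dt theta) 0 (2 * PI))) <= (2 * PI - 0) * (2 * K) * dt ^ 3).
rewrite <- RInt_minus by auto. rewrite Rmult_assoc.
apply abs_RInt_le_const; [lra | apply (ex_RInt_minus (V := R_NormedModule)); auto |].
intros theta _.
change (Rabs (w theta * g dt theta - w theta * J dt theta) <= 2 * K * dt ^ 3).
rewrite <- Rmult_minus_distr_l, Rabs_mult, Rmult_assoc.
apply Rmult_le_compat; auto using Rabs_pos.
Qed.

(** [f] is continuous only relative to the half space, but the circle stays at
    the fixed time [t], hence inside it. *)
Lemma continuous_on_circle (c : R) (f : point -> R) (x y t dt theta : R) :
  0 <= t -> continuous_on half_space f ->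
  continuous (fun theta => f (Qpt c x y t dt theta)) theta.
Proof.
intros Ht Hf.
apply (filterlim_comp _ _ _ (Qpt c x y t dt) f (locally theta)
  (within half_space (locally (Qpt c x y t dt theta)))).
2: { apply Hf. exact Ht. }
assert (Cq : continuous (Qpt c x y t dt) theta).
{ unfold Qpt. apply (continuous_comp_2
    (fun th => (x + c * dt * cos th, y + c * dt * sin th)) (fun _ => t) pair).
  - apply (continuous_comp_2 (fun th => x + c * dt * cos th)
      (fun th => y + c * dt * sin th) pair).
    + apply (ex_derive_continuous (V := R_NormedModule)). auto_derive; auto.
    + apply (ex_derive_continuous (V := R_NormedModule)). auto_derive; auto.
    + apply (continuous_ext (fun z => z)); [intros [? ?]; reflexivity|]. apply continuous_id.
  - apply continuous_const.
  - apply (continuous_ext (fun z => z)); [intros [? ?]; reflexivity|]. apply continuous_id. }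
intros P HP. unfold filtermap.
apply (filter_imp (fun th => half_space (Qpt c x y t dt th) -> P (Qpt c x y t dt th))).
- intros th Hth. apply Hth. exact Ht.
- exact (Cq _ HP).
Qed.

(** * Weighted circle integrals of quadratic polynomials *)

Lemma RInt_circle_antiderivative (G g : R -> R) :
  (forall theta : R, is_derive G theta (g theta)) ->
  (forall theta : R, continuous g theta) ->
  RInt g 0 (2 * PI) = G (2 * PI) - G 0.
Proof.
intros HG Hg. apply is_RInt_unique.
apply (is_RInt_derive G g); auto.
Qed.

Ltac circle_integral :=
  match goal with
  | |- @eq _ ?a ?b => change (@eq R a b);
     rewrite cos_2PI, sin_2PI, cos_0, sin_0; field
  | |- continuous _ _ =>
     apply (ex_derive_continuous (V := R_NormedModule)); unfold jet2; auto_derive; auto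
  | |- is_derive _ ?th _ =>
     unfold jet2; auto_derive; [auto|];
     let E := fresh in
     assert (E : sin th * sin th = 1 - cos th * cos th)
       by (pose proof (sin2_cos2 th) as HH; unfold Rsqr in HH; lra);
     field [E]
  end.

(** The four circle integrals follow from explicit antiderivatives, assembled
    coefficient by coefficient from those of the monomials
    [cos ^ i * sin ^ j]. With weight 1 the mean sees the value and the
    Laplacian. *)
Lemma circle_mean_jet2 (f0 f1 f2 f11 f12 f22 r : R) :
  RInt (fun th => 1 * jet2 f0 f1 f2 f11 f12 f22 (r * cos th) (r * sin th)) 0 (2 * PI)
  = PI * (2 * f0 + r ^ 2 / 2 * (f11 + f22)).
Proof.
rewrite (RInt_circle_antiderivative (fun th =>
  f0 * th + r * f1 * sin th - r * f2 * cos th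
  + r ^ 2 / 2 * f11 * ((th + sin th * cos th) / 2)
  + r ^ 2 * f12 * (sin th ^ 2 / 2)
  + r ^ 2 / 2 * f22 * ((th - sin th * cos th) / 2))).
all: intros; circle_integral.
Qed.

(** This weight reproduces the value and the second derivative in [x], and
    annihilates the second derivative in [y]: the quadratic moments of
    [2 * cos ^ 2 - 1 / 2] against [cos ^ 2] and [sin ^ 2] are [PI] and [0]. *)
Lemma circle_mean_jet2_cos_sqr (f0 f1 f2 f11 f12 f22 r : R) :
  RInt (fun th => (2 * cos th ^ 2 - 1 / 2)
    * jet2 f0 f1 f2 f11 f12 f22 (r * cos th) (r * sin th)) 0 (2 * PI)
  = PI * (f0 + r ^ 2 / 2 * f11).
Proof.
rewrite (RInt_circle_antiderivative (fun th =>
  f0 * (th / 2 + sin th * cos th)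
  + r * f1 * (2 * (sin th - sin th ^ 3 / 3) - sin th / 2)
  + r * f2 * (- 2 * cos th ^ 3 / 3 + cos th / 2)
  + r ^ 2 / 2 * f11 * (2 * (cos th ^ 3 * sin th / 4 + 3 / 8 * (th + sin th * cos th))
      - (th + sin th * cos th) / 4)
  + r ^ 2 * f12 * (- cos th ^ 4 / 2 - sin th ^ 2 / 4)
  + r ^ 2 / 2 * f22 * (2 * (th / 8 - sin th * cos th * (cos th ^ 2 - sin th ^ 2) / 8)
      - (th - sin th * cos th) / 4))).
all: intros; circle_integral.
Qed.

(** The counterpart of the previous weight for the second derivative in [y]. *)
Lemma circle_mean_jet2_sin_sqr (f0 f1 f2 f11 f12 f22 r : R) :
  RInt (fun th => (2 * sin th ^ 2 - 1 / 2)
    * jet2 f0 f1 f2 f11 f12 f22 (r * cos th) (r * sin th)) 0 (2 * PI)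
  = PI * (f0 + r ^ 2 / 2 * f22).
Proof.
rewrite (RInt_circle_antiderivative (fun th =>
  f0 * (th / 2 - sin th * cos th)
  + r * f1 * (2 * sin th ^ 3 / 3 - sin th / 2)
  + r * f2 * (2 * (- cos th + cos th ^ 3 / 3) + cos th / 2)
  + r ^ 2 / 2 * f11 * (2 * (th / 8 - sin th * cos th * (cos th ^ 2 - sin th ^ 2) / 8)
      - (th + sin th * cos th) / 4)
  + r ^ 2 * f12 * (sin th ^ 4 / 2 - sin th ^ 2 / 4)
  + r ^ 2 / 2 * f22 * (2 * (- sin th ^ 3 * cos th / 4 + 3 / 8 * (th - sin th * cos th))
      - (th - sin th * cos th) / 4))).
all: intros; circle_integral.
Qed.

(** Orthogonality with everything except [cos * sin] isolates the mixed
    derivative. *)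
Lemma circle_mean_jet2_sin_cos (f0 f1 f2 f11 f12 f22 r : R) :
  RInt (fun th => (2 * sin th * cos th)
    * jet2 f0 f1 f2 f11 f12 f22 (r * cos th) (r * sin th)) 0 (2 * PI)
  = PI * (r ^ 2 / 2 * f12).
Proof.
rewrite (RInt_circle_antiderivative (fun th =>
  f0 * sin th ^ 2
  + r * f1 * (- 2 * cos th ^ 3 / 3)
  + r * f2 * (2 * sin th ^ 3 / 3)
  + r ^ 2 / 2 * f11 * (- cos th ^ 4 / 2)
  + r ^ 2 * f12 * (2 * (th / 8 - sin th * cos th * (cos th ^ 2 - sin th ^ 2) / 8))
  + r ^ 2 / 2 * f22 * (sin th ^ 4 / 2))).
all: intros; circle_integral.
Qed.

(** * Second-order time expansion of acoustic solutions *)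

Lemma is_partial_x_unique (f g1 g2 : point -> R) :
  is_partial_x f g1 -> is_partial_x f g2 ->
  forall q : point, half_space q -> g1 q = g2 q.
Proof.
intros H1 H2 [[x y] t] Ht.
rewrite <- (is_derive_unique _ _ _ (H1 x y t Ht)).
apply is_derive_unique, H2, Ht.
Qed.

Lemma is_partial_y_unique (f g1 g2 : point -> R) :
  is_partial_y f g1 -> is_partial_y f g2 ->
  forall q : point, half_space q -> g1 q = g2 q.
Proof.
intros H1 H2 [[x y] t] Ht.
rewrite <- (is_derive_unique _ _ _ (H1 x y t Ht)).
apply is_derive_unique, H2, Ht.
Qed.

Lemma is_partial_t_congr (f g1 g2 : point -> R) :
  (forall q : point, half_space q -> g1 q = g2 q) ->
  is_partial_t f g1 -> is_partial_t f g2.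
Proof. intros E H x y t Ht. rewrite <- E by exact Ht. apply H, Ht. Qed.

Lemma is_partial_x_linear (f g fx gx : point -> R) (a b : R) :
  is_partial_x f fx -> is_partial_x g gx ->
  is_partial_x (fun q => a * f q + b * g q) (fun q => a * fx q + b * gx q).
Proof.
intros Hf Hg x y t Ht.
apply (is_derive_plus (V := R_NormedModule) (fun s => a * f (s, y, t))
  (fun s => b * g (s, y, t))); apply is_derive_scal.
- apply Hf, Ht.
- apply Hg, Ht.
Qed.

Lemma is_partial_y_linear (f g fy gy : point -> R) (a b : R) :
  is_partial_y f fy -> is_partial_y g gy ->
  is_partial_y (fun q => a * f q + b * g q) (fun q => a * fy q + b * gy q).
Proof.
intros Hf Hg x y t Ht.
apply (is_derive_plus (V := R_NormedModule) (fun s => a * f (x, s, t))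
  (fun s => b * g (x, s, t))); apply is_derive_scal.
- apply Hf, Ht.
- apply Hg, Ht.
Qed.

Lemma is_partial_t_linear (f g ft gt : point -> R) (a b : R) :
  is_partial_t f ft -> is_partial_t g gt ->
  is_partial_t (fun q => a * f q + b * g q) (fun q => a * ft q + b * gt q).
Proof.
intros Hf Hg x y t Ht. apply is_derive_within_linear; [apply Hf | apply Hg]; exact Ht.
Qed.

Definition second_order_partials (f fx fy fxx fxy fyy : point -> R) : Prop :=
  is_partial_x f fx /\ is_partial_y f fy /\
  is_partial_x fx fxx /\ is_partial_y fx fxy /\ is_partial_y fy fyy.

(** The equations turn time derivatives into space derivatives:
    [p_t = - c (u_x + v_y)], and differentiating once more and exchanging the order
    of derivation, [p_tt = - c (u_tx + v_ty) = c ^ 2 (p_xx + p_yy)]; similarly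
    [u_tt = - c p_tx = c ^ 2 (u_xx + v_yx)] and [v_tt = c ^ 2 (u_xy + v_yy)].
    Substitution in the Taylor expansion in time leaves only space derivatives
    at the point [(x, y, t)]. *)
Lemma acoustic_time_expansion (c : R) (p u v : point -> R) :
  class_C 3 p -> class_C 3 u -> class_C 3 v -> acoustic_solution c p u v ->
  exists px py pxx pxy pyy ux uy uxx uxy uyy vx vy vxx vxy vyy : point -> R,
    second_order_partials p px py pxx pxy pyy /\
    second_order_partials u ux uy uxx uxy uyy /\
    second_order_partials v vx vy vxx vxy vyy /\
    forall x y t : R, 0 <= t -> let q := (x, y, t) in
      eq_mod_O3 (fun dt => p (x, y, t + dt))
        (fun dt => p q - c * dt * (ux q + vy q) + (c * dt) ^ 2 / 2 * (pxx q + pyy q)) /\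
      eq_mod_O3 (fun dt => u (x, y, t + dt))
        (fun dt => u q - c * dt * px q + (c * dt) ^ 2 / 2 * (uxx q + vxy q)) /\
      eq_mod_O3 (fun dt => v (x, y, t + dt))
        (fun dt => v q - c * dt * py q + (c * dt) ^ 2 / 2 * (uxy q + vyy q)).
Proof.
intros Hp Hu Hv Hsol.
pose proof Hp as [_ [px [py [pt [Ppx [Ppy [Ppt [Cpx [Cpy _]]]]]]]]].
pose proof Hu as [_ [ux [uy [ut [Pux [Puy [Put [Cux [Cuy _]]]]]]]]].
pose proof Hv as [_ [vx [vy [vt [Pvx [Pvy [Pvt [Cvx [Cvy _]]]]]]]]].
destruct Cpx as [_ [pxx [pxy [pxt [Ppxx [Ppxy [Ppxt _]]]]]]].
destruct Cpy as [_ [pyx [pyy [pyt [Ppyx [Ppyy [Ppyt _]]]]]]].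
destruct Cux as [_ [uxx [uxy [uxt [Puxx [Puxy [Puxt _]]]]]]].
destruct Cuy as [_ [_ [uyy [_ [_ [Puyy _]]]]]].
destruct Cvx as [_ [vxx [vxy [_ [Pvxx [Pvxy _]]]]]].
destruct Cvy as [_ [vyx [vyy [vyt [Pvyx [Pvyy [Pvyt _]]]]]]].
exists px, py, pxx, pxy, pyy, ux, uy, uxx, uxy, uyy, vx, vy, vxx, vxy, vyy.
do 3 (split; [unfold second_order_partials; tauto|]).
destruct Hsol as [pt' [px' [py' [ut' [ux' [vt' [vy'
  [Hpt [Hpx [Hpy [Hut [Hux [Hvt [Hvy Heq]]]]]]]]]]]]]].
(* The derivatives in the equations and those given by the smoothness are
   a priori different functions; uniqueness identifies them on the half space. *)
assert (Ept : is_partial_t p (fun q => - c * ux q + - c * vy q)).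
{ apply is_partial_t_congr with pt'; auto. intros q Hq.
  destruct (Heq q Hq) as [E _].
  rewrite (is_partial_x_unique _ _ _ Hux Pux q Hq),
    (is_partial_y_unique _ _ _ Hvy Pvy q Hq) in E. lra. }
(* The zero term lets the rule for two-term combinations differentiate it again. *)
assert (Eut : is_partial_t u (fun q => - c * px q + 0 * px q)).
{ apply is_partial_t_congr with ut'; auto. intros q Hq.
  destruct (Heq q Hq) as [_ [E _]].
  rewrite (is_partial_x_unique _ _ _ Hpx Ppx q Hq) in E. lra. }
assert (Evt : is_partial_t v (fun q => - c * py q + 0 * py q)).
{ apply is_partial_t_congr with vt'; auto. intros q Hq.
  destruct (Heq q Hq) as [_ [_ E]].
  rewrite (is_partial_y_unique _ _ _ Hpy Ppy q Hq) in E. lra. }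
intros x y t Ht q.
assert (Euxt := mixed_partials_xt u _ _ _ _ Hu Pux Puxt Eut
  (is_partial_x_linear _ _ _ _ _ _ Ppxx Ppxx) x y t Ht). cbv beta in Euxt.
assert (Evyt := mixed_partials_yt v _ _ _ _ Hv Pvy Pvyt Evt
  (is_partial_y_linear _ _ _ _ _ _ Ppyy Ppyy) x y t Ht). cbv beta in Evyt.
assert (Epxt := mixed_partials_xt p _ _ _ _ Hp Ppx Ppxt Ept
  (is_partial_x_linear _ _ _ _ _ _ Puxx Pvyx) x y t Ht). cbv beta in Epxt.
assert (Epyt := mixed_partials_yt p _ _ _ _ Hp Ppy Ppyt Ept
  (is_partial_y_linear _ _ _ _ _ _ Puxy Pvyy) x y t Ht). cbv beta in Epyt.
assert (Evxy := mixed_partials_xy v _ _ _ _ Hv Pvx Pvxy Pvy Pvyx x y t Ht).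
fold q in Euxt, Evyt, Epxt, Epyt, Evxy.
split; [|split].
- refine (eq_mod_O3_ext _ _ _ _ (fun _ => eq_refl) _ (time_taylor p _ _ x y t Ht Hp Ept
    (is_partial_t_linear _ _ _ _ _ _ Puxt Pvyt))).
  intros dt. fold q. rewrite Euxt, Evyt. field.
- refine (eq_mod_O3_ext _ _ _ _ (fun _ => eq_refl) _ (time_taylor u _ _ x y t Ht Hu Eut
    (is_partial_t_linear _ _ _ _ _ _ Ppxt Ppxt))).
  intros dt. fold q. rewrite Epxt, Evxy. field.
- refine (eq_mod_O3_ext _ _ _ _ (fun _ => eq_refl) _ (time_taylor v _ _ x y t Ht Hv Evt
    (is_partial_t_linear _ _ _ _ _ _ Ppyt Ppyt))).
  intros dt. fold q. rewrite Epyt. field.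
Qed.

(** * Evolution formulas *)

Lemma ex_RInt_weighted_circle (w : R -> R) (c : R) (f : point -> R) (x y t dt : R) :
  (forall theta, continuous w theta) -> 0 <= t -> continuous_on half_space f ->
  ex_RInt (fun theta => w theta * f (Qpt c x y t dt theta)) 0 (2 * PI).
Proof.
intros Hw Ht Hf. apply (ex_RInt_continuous (V := R_CompleteNormedModule)).
intros theta _. apply (continuous_mult w); [apply Hw | apply continuous_on_circle; auto].
Qed.

(** At points of the circle and in weighted integrals over it, [f] may be
    replaced by its quadratic jet at the centre. *)
Lemma circle_expansion (c : R) (f fx fy fxx fxy fyy : point -> R) (x y t : R) :
  0 < c -> 0 <= t -> class_C 3 f -> second_order_partials f fx fy fxx fxy fyy ->
  let q := (x, y, t) in
  let J := fun dt theta => jet2 (f q) (fx q) (fy q) (fxx q) (fxy q) (fyy q)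
      (c * dt * cos theta) (c * dt * sin theta) in
  (forall theta : R, eq_mod_O3 (fun dt => f (Qpt c x y t dt theta)) (fun dt => J dt theta)) /\
  (forall w : R -> R,
    (forall theta, continuous w theta) -> (forall theta, Rabs (w theta) <= 2) ->
    eq_mod_O3 (fun dt => RInt (fun theta => w theta * f (Qpt c x y t dt theta)) 0 (2 * PI))
      (fun dt => RInt (fun theta => w theta * J dt theta) 0 (2 * PI))).
Proof.
intros Hc Ht Hf [Px [Py [Pxx [Pxy Pyy]]]] q J.
assert (T := circle_taylor c f fx fy fxx fxy fyy x y t Hc Ht Hf Px Py Pxx Pxy Pyy).
split.
- intros theta. exact (uniformly_eq_mod_O3_at _ _ theta T).
- intros w Cw Bw. apply (uniformly_eq_mod_O3_RInt w (fun dt theta => f (Qpt c x y t dt theta)) J); auto.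
  + intros dt. apply ex_RInt_weighted_circle; auto. apply (class_C_continuous 3), Hf.
  + intros dt. apply (ex_RInt_continuous (V := R_CompleteNormedModule)).
    intros theta _. apply (continuous_mult w); [apply Cw|].
    apply (ex_derive_continuous (V := R_NormedModule)). unfold J, jet2. auto_derive; auto.
Qed.

Lemma continuous_cos_sqr_weight (theta : R) :
  continuous (fun th => 2 * cos th ^ 2 - 1 / 2) theta.
Proof. apply (ex_derive_continuous (V := R_NormedModule)). auto_derive; auto. Qed.

Lemma continuous_sin_sqr_weight (theta : R) :
  continuous (fun th => 2 * sin th ^ 2 - 1 / 2) theta.
Proof. apply (ex_derive_continuous (V := R_NormedModule)). auto_derive; auto. Qed.

Lemma continuous_sin_cos_weight (theta : R) :
  continuous (fun th => 2 * sin th * cos th) theta.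
Proof. apply (ex_derive_continuous (V := R_NormedModule)). auto_derive; auto. Qed.

Lemma quadratic_weights_bounded (theta : R) :
  Rabs (2 * cos theta ^ 2 - 1 / 2) <= 2 /\
  Rabs (2 * sin theta ^ 2 - 1 / 2) <= 2 /\
  Rabs (2 * sin theta * cos theta) <= 2.
Proof.
pose proof (sin2_cos2 theta) as E. unfold Rsqr in E.
repeat split; apply Rabs_le; split; nra.
Qed.

Theorem mainTheorem1 (c : R) (p u v : point -> R)
  (hc : 0 < c)
  (hp : class_C 3 p) (hu : class_C 3 u) (hv : class_C 3 v)
  (hsol : acoustic_solution c p u v)
  (x y t : R) (ht : 0 <= t) :
  let Q := Qpt c x y t in
  eq_mod_O3 (fun dt => p (x, y, t + dt))
    (fun dt =>
       - p (x, y, t)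
       + 1 / PI * RInt (fun theta => p (Q dt theta)) 0 (2 * PI)
       - 1 / 2 * (u (Q dt 0) - u (Q dt PI))
       - 1 / 2 * (v (Q dt (PI / 2)) - v (Q dt (3 * PI / 2))))
  /\
  eq_mod_O3 (fun dt => u (x, y, t + dt))
    (fun dt =>
       - (1 / 2) * (p (Q dt 0) - p (Q dt PI))
       + 1 / PI * RInt (fun theta =>
             u (Q dt theta) * (2 * (cos theta) ^ 2 - 1 / 2)
             + 2 * v (Q dt theta) * sin theta * cos theta) 0 (2 * PI))
  /\
  eq_mod_O3 (fun dt => v (x, y, t + dt))
    (fun dt =>
       - (1 / 2) * (p (Q dt (PI / 2)) - p (Q dt (3 * PI / 2)))
       + 1 / PI * RInt (fun theta =>
             v (Q dt theta) * (2 * (sin theta) ^ 2 - 1 / 2)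
             + 2 * u (Q dt theta) * sin theta * cos theta) 0 (2 * PI)).
Proof.
intros Q.
pose proof (Rgt_not_eq _ _ PI_RGT_0) as PI0.
destruct (acoustic_time_expansion c p u v hp hu hv hsol) as
  [px [py [pxx [pxy [pyy [ux [uy [uxx [uxy [uyy [vx [vy [vxx [vxy [vyy
  [Jp [Ju [Jv T]]]]]]]]]]]]]]]]]].
destruct (T x y t ht) as [Tp [Tu Tv]]. clear T.
destruct (circle_expansion c p _ _ _ _ _ x y t hc ht hp Jp) as [Pp Ip].
destruct (circle_expansion c u _ _ _ _ _ x y t hc ht hu Ju) as [Pu Iu].
destruct (circle_expansion c v _ _ _ _ _ x y t hc ht hv Jv) as [Pv Iv].
set (q := (x, y, t)) in *.
assert (cos3 : cos (3 * PI / 2) = 0)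
  by (replace (3 * PI / 2) with (3 * (PI / 2)) by field; apply cos_3PI2).
assert (sin3 : sin (3 * PI / 2) = -1)
  by (replace (3 * PI / 2) with (3 * (PI / 2)) by field; apply sin_3PI2).
(* In each case the time expansion and the right-hand side, in which values on
   the circle are replaced by jets, are one and the same polynomial in [dt]. *)
split; [|split].
- eapply eq_mod_O3_trans_sym; [exact Tp|].
  refine (eq_mod_O3_ext _ _ _ _ _ _
    (eq_mod_O3_linear _ _ _ _ 1 1
      (eq_mod_O3_linear _ _ _ _ (-1) (1 / PI) (eq_mod_O3_of_eq (fun _ => p q) _ (fun _ => eq_refl))
        (Ip (fun _ => 1) (fun th => continuous_const _ _) _))
      (eq_mod_O3_linear _ _ _ _ (- (1 / 2)) (- (1 / 2))
        (eq_mod_O3_linear _ _ _ _ 1 (-1) (Pu 0) (Pu PI))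
        (eq_mod_O3_linear _ _ _ _ 1 (-1) (Pv (PI / 2)) (Pv (3 * PI / 2)))))).
  + intros dt. cbv beta.
    rewrite (RInt_ext (fun th => 1 * p (Qpt c x y t dt th)) (fun th => p (Q dt th)))
      by (intros; apply Rmult_1_l).
    unfold Q. ring.
  + intros dt. cbv beta. rewrite circle_mean_jet2.
    unfold jet2. rewrite cos3, sin3, cos_0, sin_0, cos_PI, sin_PI, cos_PI2, sin_PI2. field. auto.
  + intros _. rewrite Rabs_R1. lra.
- eapply eq_mod_O3_trans_sym; [exact Tu|].
  refine (eq_mod_O3_ext _ _ _ _ _ _
    (eq_mod_O3_linear _ _ _ _ (- (1 / 2)) (1 / PI)
      (eq_mod_O3_linear _ _ _ _ 1 (-1) (Pp 0) (Pp PI))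
      (eq_mod_O3_linear _ _ _ _ 1 1
        (Iu _ continuous_cos_sqr_weight (fun th => proj1 (quadratic_weights_bounded th)))
        (Iv _ continuous_sin_cos_weight (fun th => proj2 (proj2 (quadratic_weights_bounded th))))))).
  + intros dt. cbv beta. rewrite !Rmult_1_l.
    rewrite <- (RInt_plus (V := R_CompleteNormedModule)).
    * f_equal; [unfold Q; ring|]. f_equal.
      apply RInt_ext. intros th _. unfold plus, Q; simpl. ring.
    * apply ex_RInt_weighted_circle; auto using continuous_cos_sqr_weight.
      apply (class_C_continuous 3), hu.
    * apply ex_RInt_weighted_circle; auto using continuous_sin_cos_weight.
      apply (class_C_continuous 3), hv.
  + intros dt. cbv beta. rewrite circle_mean_jet2_cos_sqr, circle_mean_jet2_sin_cos.
    unfold jet2. rewrite cos_0, sin_0, cos_PI, sin_PI. field. auto.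
- eapply eq_mod_O3_trans_sym; [exact Tv|].
  refine (eq_mod_O3_ext _ _ _ _ _ _
    (eq_mod_O3_linear _ _ _ _ (- (1 / 2)) (1 / PI)
      (eq_mod_O3_linear _ _ _ _ 1 (-1) (Pp (PI / 2)) (Pp (3 * PI / 2)))
      (eq_mod_O3_linear _ _ _ _ 1 1
        (Iv _ continuous_sin_sqr_weight (fun th => proj1 (proj2 (quadratic_weights_bounded th))))
        (Iu _ continuous_sin_cos_weight (fun th => proj2 (proj2 (quadratic_weights_bounded th))))))).
  + intros dt. cbv beta. rewrite !Rmult_1_l.
    rewrite <- (RInt_plus (V := R_CompleteNormedModule)).
    * f_equal; [unfold Q; ring|]. f_equal.
      apply RInt_ext. intros th _. unfold plus, Q; simpl. ring.
    * apply ex_RInt_weighted_circle; auto using continuous_sin_sqr_weight.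
      apply (class_C_continuous 3), hv.
    * apply ex_RInt_weighted_circle; auto using continuous_sin_cos_weight.
      apply (class_C_continuous 3), hu.
  + intros dt. cbv beta. rewrite circle_mean_jet2_sin_sqr, circle_mean_jet2_sin_cos.
    unfold jet2. rewrite cos3, sin3, cos_PI2, sin_PI2. field. auto.
Qed.
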